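(* Let $L$ be a loop with left representation $\Pi_\lambda$ and right representation $\Pi_\rho$. Then: (1) $L$ is an LC-loop if and only if for all $\alpha,\beta\in\Pi_\lambda$ one has $\alpha\beta^2\in\Pi_\lambda$; (2) $L$ is an RC-loop if and only if for all $\alpha,\beta\in\Pi_\rho$ one has $\alpha\beta^2\in\Pi_\rho$.
   Context: A loop is a quasigroup with a two-sided identity element. For $x$ in a loop $L$, the translations $L_x,R_x:L\to L$ are the bijections $yL_x=xy$ and $yR_x=yx$. Maps are written on the right of their arguments and composed from left to right, so $y(\alpha\beta)=(y\alpha)\beta$. The left representation of $L$ is $\Pi_\lambda=\{L_x : x\in L\}$ and the right representation is $\Pi_\rho=\{R_x : x\in L\}$. $L$ is an LC-loop if $(xx)(yz)=(x(xy))z$ for all $x,y,z\in L$, and an RC-loop if $(zy)(xx)=z((yx)x)$ for all $x,y,z\in L$. *)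

(* Defs.v *)
From HB Require Import structures.
From mathcomp Require Import all_boot.
From mathcomp Require Import classical_sets.

Set Implicit Arguments.
Unset Strict Implicit.
Unset Printing Implicit Defensive.

Local Open Scope classical_set_scope.
Local Open Scope group_scope.

HB.mixin Record Magma_isQuasigroup G of Magma G := {
  ldiv_ex_unique : forall a b : G, exists! x : G, a * x = b;
  rdiv_ex_unique : forall a b : G, exists! y : G, y * a = b
}.

#[short(type="quasigroupType")]
HB.structure Definition Quasigroup := {G of Magma_isQuasigroup G & Magma G}.

(* The library's umagmaType is not reused: it would also require the carrier to
   be a choiceType. *)
HB.mixin Record BaseUMagma_hasIdentity G of BaseUMagma G := {
  loop_mul1g : left_id (1 : G) mul;
  loop_mulg1 : right_id (1 : G) mul
}.

#[short(type="loopType")]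
HB.structure Definition Loop :=
  {G of BaseUMagma_hasIdentity G & Quasigroup G & BaseUMagma G}.

Bind Scope group_scope with Loop.sort.

Section LoopDefs.

Variable L : loopType.

(* Translations act on the right: y L_x = x y and y R_x = y x. *)
Definition ltranslation (x : L) : L -> L := fun y => x * y.
Definition rtranslation (x : L) : L -> L := fun y => y * x.

Definition lrepresentation : set (L -> L) := range ltranslation.
Definition rrepresentation : set (L -> L) := range rtranslation.

Definition LC_loop : Prop :=
  forall x y z : L, (x * x) * (y * z) = (x * (x * y)) * z.

Definition RC_loop : Prop :=
  forall x y z : L, (z * y) * (x * x) = z * ((y * x) * x).

End LoopDefs.

Arguments lrepresentation : clear implicits.
Arguments rrepresentation : clear implicits.

(* Main.v *)
Require Import Defs.
From HB Require Import structures.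
From mathcomp Require Import all_boot.
From mathcomp Require Import classical_sets.
From mathcomp Require Import boolp.

(* Evaluating at 1 shows that L_y L_x^2 can only be the translation by x(xy), so
   closure says exactly that x(x(yz)) = (x(xy))z.  This law and the LC law both
   imply x(xz) = (xx)z (put y = 1, respectively z = 1), which turns each into
   the other.  The right-hand case is dual. *)

Local Open Scope group_scope.

Lemma lrepresentation_closedP (L : loopType) :
  (forall alpha beta : L -> L,
     lrepresentation L alpha -> lrepresentation L beta ->
     lrepresentation L (alpha \; (beta \; beta))) <->
  (forall x y z : L, x * (x * (y * z)) = (x * (x * y)) * z).
Proof.
split=> [closed x y z | law _ _ [y _ <-] [x _ <-]].
  have [w _ Ew] := closed (ltranslation y) (ltranslation x)
                     (ex_intro2 _ _ y I erefl) (ex_intro2 _ _ x I erefl).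
  (* The equality of maps [Ew] is evaluated at [t]. Since [\;] applies its left factor first, [y]
     ends up innermost. *)
  have Ewz t : w * t = x * (x * (y * t)) := congr1 (@^~ t) Ew.
  (* Expanding [w] to [w * 1] lets [Ewz] at [t = 1] compute it. *)
  by rewrite -Ewz -[w]loop_mulg1 Ewz loop_mulg1.
by exists (x * (x * y)) => //; apply/funext=> z; rewrite /ltranslation /= law.
Qed.

Lemma rrepresentation_closedP (L : loopType) :
  (forall alpha beta : L -> L,
     rrepresentation L alpha -> rrepresentation L beta ->
     rrepresentation L (alpha \; (beta \; beta))) <->
  (forall x y z : L, ((z * y) * x) * x = z * ((y * x) * x)).
Proof.
split=> [closed x y z | law _ _ [y _ <-] [x _ <-]].
  have [w _ Ew] := closed (rtranslation y) (rtranslation x)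
                     (ex_intro2 _ _ y I erefl) (ex_intro2 _ _ x I erefl).
  have Ewz t : t * w = ((t * y) * x) * x := congr1 (@^~ t) Ew.
  (* The value at 1 of the right translation by [w] is [1 * w], hence this expansion. *)
  by rewrite -Ewz -[w]loop_mul1g Ewz loop_mul1g.
by exists ((y * x) * x) => //; apply/funext=> z; rewrite /rtranslation /= law.
Qed.

Lemma LC_loopP (L : loopType) :
  LC_loop L <-> forall x y z : L, x * (x * (y * z)) = (x * (x * y)) * z.
Proof.
split=> [lc | law] x y z.
  have alt t : (x * x) * t = x * (x * t).
    by have := lc x t 1; rewrite !loop_mulg1.
  (* Used at [t = y * z] only, [alt] leaves the inner [x * (x * y)] intact for [lc]. *)
  by rewrite -alt lc.
have alt t : x * (x * t) = (x * x) * t.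
  by have := law x 1 t; rewrite loop_mul1g loop_mulg1.
by rewrite -alt law.
Qed.

Lemma RC_loopP (L : loopType) :
  RC_loop L <-> forall x y z : L, ((z * y) * x) * x = z * ((y * x) * x).
Proof.
split=> [rc | law] x y z.
  have alt t : t * (x * x) = (t * x) * x.
    by have := rc x t 1; rewrite !loop_mul1g.
  by rewrite -alt rc.
have alt t : (t * x) * x = t * (x * x).
  by have := law x 1 t; rewrite loop_mul1g loop_mulg1.
(* Here [t = z * y]: the square splits into two multiplications by [x], as [law] requires. *)
by rewrite -alt law.
Qed.

Local Close Scope group_scope.

(* Maps act on the right, so the product of maps alpha beta is the diagrammatic
   composition alpha \; beta, that is, y |-> beta (alpha y). *)
Theorem theorem3p1 (L : loopType) :
  (LC_loop L <->
     forall alpha beta : L -> L,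
       lrepresentation L alpha -> lrepresentation L beta ->
       lrepresentation L (alpha \; (beta \; beta))) /\
  (RC_loop L <->
     forall alpha beta : L -> L,
       rrepresentation L alpha -> rrepresentation L beta ->
       rrepresentation L (alpha \; (beta \; beta))).
Proof.
split; first by rewrite LC_loopP lrepresentation_closedP.
by rewrite RC_loopP rrepresentation_closedP.
Qed.
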